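(* Let $\mathbf{ILP}$ be the smallest logic extending $\mathbf{IL}$ that contains all instances of the scheme $\mathsf P$: $A \rhd B \rightarrow \Box(A\rhd B)$. Then: (1) $\mathbf{ILP}$ is complete with respect to the class of all generalised Veltman frames satisfying the condition $\mathsf P_{\mathrm{gen}}$: for every formula $A$, if $A$ is valid on every generalised Veltman frame satisfying $\mathsf P_{\mathrm{gen}}$, then $\mathbf{ILP}\vdash A$. (2) In particular, $\mathbf{ILP}$ is complete with respect to the class of $\mathbf{ILWP}$-structures for all appropriate sets $\mathcal D$ (finite sets of formulas containing $\top$ that are closed under subformulas and single negations): for every formula $A$, if $A$ is true at every world of the $\mathbf{ILWP}$-structure for $\mathcal D$, for every appropriate $\mathcal D$, then $\mathbf{ILP}\vdash A$.
   Context: Formulas are built from $\bot$, countably many propositional variables, $\to$, unary $\Box$ and binary $\rhd$; $\Diamond A:=\neg\Box\neg A$, $\top := \bot\to\bot$, other connectives are abbreviations. $\mathbf{IL}$ is axiomatised by all classical tautologies (in this language) and K: $\Box(A\to B)\to(\Box A\to\Box B)$; L: $\Box(\Box A\to A)\to\Box A$; J1: $\Box(A\to B)\to A\rhd B$; J2: $(A\rhd B)\wedge(B\rhd C)\to A\rhd C$; J3: $(A\rhd C)\wedge(B\rhd C)\to A\vee B\rhd C$; J4: $A\rhd B\to(\Diamond A\to\Diamond B)$; J5: $\Diamond A\rhd A$, with rules modus ponens and necessitation ($A/\Box A$). An $\mathbf{ILP}$-MCS is a set of formulas that is $\mathbf{ILP}$-consistent and maximal with this property. For MCSs $\Gamma,\Delta$: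 $\Gamma\prec\Delta$ iff for every $A$, $\Box A\in\Gamma$ implies $A,\Box A\in\Delta$. For a set $S$ of formulas, $\Gamma\prec_S\Delta$ iff for every formula $A$ and every finite $S'\subseteq S$, if $\neg A\rhd\bigvee_{\sigma\in S'}\neg\sigma\in\Gamma$ then $A,\Box A\in\Delta$ (the empty disjunction is $\bot$). For a MCS $\Gamma$ and set $T$: $\Gamma^{\boxdot}_T=\{A,\Box A : \neg A\rhd\bigvee_{\sigma\in T'}\neg\sigma\in\Gamma$ for some finite $T'\subseteq T\}$. A generalised Veltman frame is $(W,R,\{S_w\}_{w\in W})$ with $W\neq\emptyset$, $R$ transitive and conversely well-founded, and for each $w$, with $R[w]=\{x: wRx\}$: $S_w\subseteq R[w]\times(\mathcal P(R[w])\setminus\{\emptyset\})$; $wRu$ implies $uS_w\{u\}$; if $uS_wV$ and $vS_wZ_v$ for all $v\in V$ then $uS_w\bigcup_{v\in V}Z_v$; $wRuRv$ implies $uS_w\{v\}$; if $uS_wV$ and $V\subseteq Z\subseteq R[w]$ then $uS_wZ$. A model adds a forcing relation with the Boolean clauses, $w\Vdash\Box A$ iff all $R$-successors force $A$, and $w\Vdash A\rhd B$ iff for every $u$ with $wRu$ and $u\Vdash A$ there is $V$ with $uS_wV$ and $v\Vdash B$ for all $v\in V$. $\mathsf P_{\mathrm{gen}}$: $wRw'RuS_wV$ implies there is $V'\subseteq V$ with $uS_{w'}V'$. Given a sequence of MCSs $w_0,\dots,w_n$ ($n\ge 1$), sets $S_1,\dots,S_n$ and a formula $B$, define $Q_1(B)=S_1\cup\{\Box\neg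 B\}$ and $Q_{j+1}(B)=S_{j+1}\cup\{\Box\neg B\}\cup (w_j)^{\boxdot}_{Q_j(B)}$. For an appropriate $\mathcal D$, the $\mathbf{ILWP}$-structure for $\mathcal D$ is $(W,R,\{S_w\},\Vdash)$ where: $W$ is the set of $\mathbf{ILP}$-MCSs $w$ such that $B\wedge\Box\neg B\in w$ for some $B\in\mathcal D$; $wRu$ iff $w\prec u$; $uS_wV$ iff $wRu$, $V\subseteq R[w]$ and either (a) $V\cap\dot R[u]\neq\emptyset$, where $\dot R[u]=R[u]\cup\{u\}$, or (b) for all $n\ge1$, all $\mathbf{ILP}$-MCSs $w_0,\dots,w_n$ and all sets $S_1,\dots,S_n$ with $w=w_n\prec_{S_n}w_{n-1}\prec_{S_{n-1}}\cdots\prec_{S_1}w_0=u$, there exist $v\in V$ and $B\in\mathcal D\cap\bigcup\dot R[u]$ with $w\prec_{Q_n(B)}v$ ($Q_n$ computed from these $w_i,S_i$); and $w\Vdash p$ iff $p\in w$. *)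

(* Defs.v *)
From HB Require Import structures.
From mathcomp Require Import all_boot.
From mathcomp Require Import boolp classical_sets functions cardinality.

Set Implicit Arguments.
Unset Strict Implicit.
Unset Printing Implicit Defensive.

Local Open Scope classical_set_scope.

Inductive form : Type :=
| Bot
| Var of nat
| Imp of form & form
| Box of form
| Rhd of form & form.

Fixpoint form_encode (A : form) : GenTree.tree nat :=
  match A with
  | Bot => GenTree.Node 0 [::]
  | Var p => GenTree.Leaf p
  | Imp A B => GenTree.Node 1 [:: form_encode A; form_encode B]
  | Box A => GenTree.Node 2 [:: form_encode A]
  | Rhd A B => GenTree.Node 3 [:: form_encode A; form_encode B]
  end.

Fixpoint form_decode (t : GenTree.tree nat) : option form :=
  match t with
  | GenTree.Leaf p => Some (Var p)
  | GenTree.Node 0 [::] => Some Bot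
  | GenTree.Node 1 [:: s; t] =>
      if (form_decode s, form_decode t) is (Some A, Some B)
      then Some (Imp A B) else None
  | GenTree.Node 2 [:: s] => omap Box (form_decode s)
  | GenTree.Node 3 [:: s; t] =>
      if (form_decode s, form_decode t) is (Some A, Some B)
      then Some (Rhd A B) else None
  | _ => None
  end.

Lemma form_encodeK : pcancel form_encode form_decode.
Proof. by elim=> //= [A -> B ->|A ->|A -> B ->]. Qed.

HB.instance Definition _ := Countable.copy form (pcan_type form_encodeK).

Declare Scope form_scope.
Delimit Scope form_scope with F.
Bind Scope form_scope with form.
Local Open Scope form_scope.

Definition Neg (A : form) : form := Imp A Bot.
Definition Top : form := Imp Bot Bot.
Definition Or (A B : form) : form := Imp (Neg A) B.
Definition And (A B : form) : form := Neg (Imp A (Neg B)).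
Definition Dia (A : form) : form := Neg (Box (Neg A)).

Infix "~~>" := Imp (at level 60, right associativity) : form_scope.
Infix "|>" := Rhd (at level 55, no associativity) : form_scope.
Infix "`\/`" := Or (at level 50, left associativity) : form_scope.
Infix "`/\`" := And (at level 48, left associativity) : form_scope.

Definition bigOr (s : seq form) : form := foldr Or Bot s.
Definition bigAnd (s : seq form) : form := foldr And Top s.

(* Truth value when boxed and |>-formulas are treated as atoms. *)
Fixpoint truth_value (v : form -> bool) (A : form) : bool :=
  match A with
  | Bot => false
  | Imp A B => truth_value v A ==> truth_value v B
  | _ => v A
  end.

Definition tautology (A : form) : Prop := forall v, truth_value v A.

(* [provable X] is the least logic extending IL that contains [X]. *)
Inductive provable (X : set form) : form -> Prop :=
| ax_taut A : tautology A -> provable X A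
| ax_K A B : provable X (Box (A ~~> B) ~~> (Box A ~~> Box B))
| ax_L A : provable X (Box (Box A ~~> A) ~~> Box A)
| ax_J1 A B : provable X (Box (A ~~> B) ~~> (A |> B))
| ax_J2 A B C : provable X ((A |> B) `/\` (B |> C) ~~> (A |> C))
| ax_J3 A B C : provable X ((A |> C) `/\` (B |> C) ~~> ((A `\/` B) |> C))
| ax_J4 A B : provable X ((A |> B) ~~> (Dia A ~~> Dia B))
| ax_J5 A : provable X (Dia A |> A)
| ax_extra A : X A -> provable X A
| rule_MP A B : provable X (A ~~> B) -> provable X A -> provable X B
| rule_Nec A : provable X A -> provable X (Box A).

Definition schemeP : set form :=
  [set C | exists A B, C = ((A |> B) ~~> Box (A |> B))].

Definition ILP : form -> Prop := provable schemeP.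

Definition consistent (Gamma : set form) : Prop :=
  forall s : seq form, [set` s] `<=` Gamma -> ~ ILP (bigAnd s ~~> Bot).

Definition MCS (Gamma : set form) : Prop :=
  consistent Gamma /\
  forall Delta, consistent Delta -> Gamma `<=` Delta -> Delta `<=` Gamma.

Definition prec (Gamma Delta : set form) : Prop :=
  forall A, Gamma (Box A) -> Delta A /\ Delta (Box A).

(* Finite subsets are given by arbitrary enumerations [s]; a maximal consistent
   set cannot distinguish the disjunctions along two enumerations. *)
Definition precS (S Gamma Delta : set form) : Prop :=
  forall (A : form) (s : seq form), [set` s] `<=` S ->
    Gamma (Neg A |> bigOr (map Neg s)) -> Delta A /\ Delta (Box A).

Definition boxdot (Gamma T : set form) : set form :=
  [set C | exists A (s : seq form),
     [/\ [set` s] `<=` T, Gamma (Neg A |> bigOr (map Neg s))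
       & C = A \/ C = Box A]].

(* Only the values at positive indices are meaningful. *)
Fixpoint Qset (w S : nat -> set form) (B : form) (j : nat) : set form :=
  match j with
  | 0 => set0
  | 1 => S 1 `|` [set Box (Neg B)]
  | i.+1 => S i.+1 `|` [set Box (Neg B)] `|` boxdot (w i) (Qset w S B i)
  end.

(* The raw data of a frame, without any condition. *)
Record structure := Structure {
  world : Type;
  Racc : world -> set world;
  Sacc : world -> world -> set (set world)
}.

Record gv_frame (F : structure) : Prop := GVFrame {
  gv_inhabited : inhabited (world F);
  gv_trans : forall w u v : world F, Racc w u -> Racc u v -> Racc w v;
  gv_cwf : well_founded (fun x y : world F => Racc y x);
  gv_dom : forall (w u : world F) V, Sacc w u V ->
    [/\ Racc w u, V `<=` Racc w & V !=set0];
  gv_refl : forall w u : world F, Racc w u -> Sacc w u [set u];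
  gv_quasitrans : forall (w u : world F) V (Z : world F -> set (world F)),
    Sacc w u V -> (forall v, V v -> Sacc w v (Z v)) ->
    Sacc w u (\bigcup_(v in V) Z v);
  gv_rel : forall w u v : world F, Racc w u -> Racc u v -> Sacc w u [set v];
  gv_mono : forall (w u : world F) V Z,
    Sacc w u V -> V `<=` Z -> Z `<=` Racc w -> Sacc w u Z
}.

Definition Pgen (F : structure) : Prop :=
  forall (w w' u : world F) V, Racc w w' -> Racc w' u -> Sacc w u V ->
    exists2 V', V' `<=` V & Sacc w' u V'.

Fixpoint forces (F : structure) (val : nat -> set (world F)) (w : world F)
    (A : form) : Prop :=
  match A with
  | Bot => False
  | Var p => val p w
  | Imp A B => forces val w A -> forces val w B
  | Box A => forall u, Racc w u -> forces val u A
  | Rhd A B => forall u, Racc w u -> forces val u A ->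
      exists2 V, Sacc w u V & forall v, V v -> forces val v B
  end.

Definition valid (F : structure) (A : form) : Prop :=
  forall (val : nat -> set (world F)) (w : world F), forces val w A.

Fixpoint subforms (A : form) : seq form :=
  A :: match A with
       | Bot | Var _ => [::]
       | Imp A B | Rhd A B => subforms A ++ subforms B
       | Box A => subforms A
       end.

Definition single_neg (A : form) : form :=
  if A is Imp B Bot then B else Neg A.

Definition appropriate (D : set form) : Prop :=
  [/\ finite_set D, D Top,
      forall A B, D A -> B \in subforms A -> D B
    & forall A, D A -> D (single_neg A)].

Record ILWP_world (D : set form) : Type := ILWPWorld {
  theory : set form;
  theory_MCS : MCS theory;
  theory_D : exists2 B, D B & theory (B `/\` Box (Neg B))
}.

Definition ILWP_Racc (D : set form) (w : ILWP_world D) : set (ILWP_world D) :=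
  [set u | prec (theory w) (theory u)].

Definition ILWP_Rdot (D : set form) (u : ILWP_world D) : set (ILWP_world D) :=
  ILWP_Racc u `|` [set u].

(* Only [ws 0], ..., [ws n] and [Ss 1], ..., [Ss n] are relevant. *)
Definition labelled_chain (n : nat) (ws Ss : nat -> set form)
    (w u : set form) : Prop :=
  [/\ forall i, i <= n -> MCS (ws i), ws n = w, ws 0 = u
    & forall i, i < n -> precS (Ss i.+1) (ws i.+1) (ws i)].

Definition ILWP_Sacc (D : set form) (w u : ILWP_world D) :
    set (set (ILWP_world D)) :=
  [set V | [/\ ILWP_Racc w u, V `<=` ILWP_Racc w
    & V `&` ILWP_Rdot u !=set0 \/
      forall (n : nat) (ws Ss : nat -> set form), 1 <= n ->
        labelled_chain n ws Ss (theory w) (theory u) ->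
        exists v B, [/\ V v,
          (D `&` \bigcup_(x in ILWP_Rdot u) theory x) B
          & precS (Qset ws Ss B n) (theory w) (theory v)]]].

Definition ILWP_structure (D : set form) : structure :=
  @Structure (ILWP_world D) (@ILWP_Racc D) (@ILWP_Sacc D).

Definition ILWP_val (D : set form) (p : nat) : set (world (ILWP_structure D)) :=
  [set w : ILWP_world D | theory w (Var p)].

(* Main.v *)
Require Import Defs.
From mathcomp Require Import all_boot.
From mathcomp Require Import boolp classical_sets functions cardinality.

Set Implicit Arguments.
Unset Strict Implicit.
Unset Printing Implicit Defensive.

Local Open Scope classical_set_scope.
Local Open Scope form_scope.

(** Both parts follow from a truth lemma for the ILWP-structure of an appropriate
    set [D], together with the fact that this structure is a generalised Veltman
    frame satisfying Pgen.

    If [A |> B] is not in [w], a successor [u] containing [A] with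
    [w prec_{~B} u] refutes it: the one-step chain forces every [V] with
    [u S_w V] to meet the worlds containing [~B].  If [A |> B] is in [w] and [A]
    is in [u], then for a chain from [w] to [u] a world [v] containing [B] with
    [w prec_{Q_n(A)} v] exists unless [A] interprets a finite disjunction of
    negations from [Q_n(A)] in [w].  Such a formula would travel down the chain by
    P, each layer [boxdot (w_j) Q_j(A)] of [Q_{j+1}(A)] being eliminated inside
    [w_j], and at the last step W removes [Box ~A], which contradicts
    [w_1 prec_{S_1} u].

    For Pgen, a chain from [w'] to [u] is prolonged by [w prec_{0} w']; the set
    [Q_{n+1}(B)] then contains [boxdot w' Q_n(B)], so that [w prec_{Q_{n+1}(B)} v]
    yields [w' prec_{Q_n(B)} v]. *)

(** * Derivability and maximal consistent sets *)

Lemma truth_bigAnd v s : truth_value v (bigAnd s) = all (truth_value v) s.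
Proof.
by elim: s => //= x s <-; case: (truth_value v x); case: (truth_value v _).
Qed.

Lemma ILP_taut_MP A B : tautology (A ~~> B) -> ILP A -> ILP B.
Proof. by move=> tAB; apply: rule_MP; apply: ax_taut. Qed.

Lemma ILP_taut_MP2 A B C :
  tautology (A ~~> B ~~> C) -> ILP A -> ILP B -> ILP C.
Proof. by move=> tABC /(ILP_taut_MP tABC); apply: rule_MP. Qed.

(** Premises occur only as antecedents of a theorem, so necessitation never applies to them and the
    deduction theorem holds without restriction. *)
Definition derives (G : set form) (A : form) : Prop :=
  exists2 s : seq form, [set` s] `<=` G & ILP (bigAnd s ~~> A).

Lemma consistentNP G : ~ consistent G <-> derives G Bot.
Proof.
split=> [ncG|[s sG ds] cG]; last exact: cG sG ds.
by apply: contrapT => nd; apply: ncG => s sG ds; apply: nd; exists s.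
Qed.

Lemma derives_ax (G : set form) A : G A -> derives G A.
Proof.
move=> GA; exists [:: A]; first by move=> x /=; rewrite inE => /eqP->.
by apply: ax_taut => v /=; case: (truth_value v A).
Qed.

Lemma derives_ILP G A : ILP A -> derives G A.
Proof.
move=> dA; exists [::] => //; apply: ILP_taut_MP dA => v /=.
by case: (truth_value v A).
Qed.

Lemma derives_MP G A B : derives G (A ~~> B) -> derives G A -> derives G B.
Proof.
move=> [s sG ds] [t tG dt]; exists (s ++ t).
  by move=> x /=; rewrite mem_cat => /orP[/sG|/tG].
apply: ILP_taut_MP2 ds dt => v /=; rewrite !truth_bigAnd all_cat.
by case: (all _ s); case: (all _ t);
  case: (truth_value v A); case: (truth_value v B).
Qed.

Lemma derives_deduction G A B :
  derives (G `|` [set A]) B -> derives G (A ~~> B).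
Proof.
move=> [s sG ds]; exists [seq x <- s | x != A].
  move=> x /=; rewrite mem_filter => /andP[/eqP xA /sG[//|/=]].
  by move/xA.
apply: ILP_taut_MP ds => v /=; rewrite !truth_bigAnd.
have [vA|] := boolP (truth_value v A); last by rewrite !implybT.
suff -> : all (truth_value v) [seq x <- s | x != A] = all (truth_value v) s.
  by rewrite implybb.
rewrite all_filter; apply: eq_all => x /=.
by case: eqVneq => //= ->; rewrite vA.
Qed.

Lemma Lindenbaum G : consistent G -> exists2 D, MCS D & G `<=` D.
Proof.
(* Zorn ranges over the [X] that are consistent together with [G], not over consistent supersets of
   [G]; thus the empty union of the empty chain is admissible too. *)
move=> cG; have [F FP|M [cM maxM]] :=
    @Zorn_bigcup form [set X | consistent (G `|` X)].
  move=> totF /= s; have [->|/set0P[X0 FX0]] := eqVneq F set0.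
    by rewrite bigcup_set0 setU0; apply: cG.
  move=> sGF; suff [X FX sX] : exists2 X, F X & [set` s] `<=` G `|` X.
    exact: (FP _ FX).
  elim: s sGF => [|x s IHs] sGF; first by exists X0.
  have [y /= ys|X FX sX] := IHs; first by apply: sGF; rewrite /= inE ys orbT.
  have [Gx|[Y FY Yx]] := sGF x (mem_head _ _).
    exists X => // y /=; rewrite inE => /orP[/eqP->|/sX //]; by left.
  have [XY|YX] := totF _ _ FX FY.
    exists Y => // y /=; rewrite inE => /orP[/eqP->|/sX[]]; first by right.
      by left.
    by right; apply: XY.
  exists X => // y /=; rewrite inE => /orP[/eqP->|/sX //]; by right; apply: YX.
exists (G `|` M); last exact: subsetUl.
split=> // D cD GMD x Dx; right; apply: contrapT => nMx.
apply: (maxM (M `|` D)); last first.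
  by rewrite /= setUA setUC setUidl.
by split=> [|MD]; [exact: subsetUl | apply: nMx; apply: MD; right].
Qed.

Lemma MCS_derives G A : MCS G -> derives G A -> G A.
Proof.
move=> [cG maxG] dA; apply: (maxG (G `|` [set A])).
- apply: contrapT => /consistentNP/derives_deduction dNA.
  by have /consistentNP := derives_MP dNA dA.
- exact: subsetUl.
- by right.
Qed.

Lemma MCS_ILP G A : MCS G -> ILP A -> G A.
Proof. by move=> mG dA; apply: MCS_derives => //; apply: derives_ILP. Qed.

Lemma MCS_MP G A B : MCS G -> G (A ~~> B) -> G A -> G B.
Proof.
move=> mG GAB GA; apply: MCS_derives => //.
by apply: derives_MP; apply: derives_ax; [exact: GAB|].
Qed.

Lemma MCS_Bot G : MCS G -> ~ G Bot.
Proof. by move=> [cG _] /derives_ax /consistentNP. Qed.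

Lemma MCS_Neg G A : MCS G -> G (Neg A) <-> ~ G A.
Proof.
move=> mG; split=> [GNA /(MCS_MP mG GNA)|nGA]; first exact: MCS_Bot.
apply: MCS_derives => //; apply: derives_deduction; apply/consistentNP => cGA.
by apply: nGA; apply: (mG.2 _ cGA); [exact: subsetUl|right].
Qed.

Lemma MCS_Imp G A B : MCS G -> G (A ~~> B) <-> (G A -> G B).
Proof.
move=> mG; split=> [|AB]; first exact: MCS_MP.
have [/AB GB|/(MCS_Neg A mG) GNA] := pselect (G A).
  apply: MCS_MP GB => //; apply: MCS_ILP => //; apply: ax_taut => v /=.
  by case: (truth_value v A); case: (truth_value v B).
apply: MCS_MP GNA => //; apply: MCS_ILP => //; apply: ax_taut => v /=.
by case: (truth_value v A); case: (truth_value v B).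
Qed.

Lemma MCS_Or G A B : MCS G -> G (A `\/` B) <-> G A \/ G B.
Proof.
move=> mG; rewrite /Or (MCS_Imp _ _ mG) (MCS_Neg _ mG).
by have [] := pselect (G A); tauto.
Qed.

Lemma MCS_And G A B : MCS G -> G (A `/\` B) <-> G A /\ G B.
Proof.
move=> mG; rewrite /And (MCS_Neg _ mG) (MCS_Imp _ _ mG) (MCS_Neg _ mG).
by have [] := pselect (G A); have [] := pselect (G B); tauto.
Qed.

Lemma MCS_bigAnd G s : MCS G -> G (bigAnd s) <-> [set` s] `<=` G.
Proof.
move=> mG; elim: s => [|x s IHs] /=.
  by split=> // _; apply/MCS_Imp.
rewrite MCS_And // IHs; split=> [[Gx sG] y /=|sG].
  by rewrite inE => /orP[/eqP->|/sG].
by split=> [|y /= ys]; apply: sG; rewrite /= inE ?eqxx ?ys ?orbT.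
Qed.

Lemma MCS_bigOr_Neg G s :
  MCS G -> G (bigOr (map Neg s)) <-> exists2 x, x \in s & ~ G x.
Proof.
move=> mG; elim: s => [|x s IHs] /=.
  by split=> [/(MCS_Bot mG)|[]].
rewrite MCS_Or // IHs MCS_Neg //; split=> [[nGx|[y ys nGy]]|[y]].
- by exists x => //; rewrite mem_head.
- by exists y => //; rewrite inE ys orbT.
- by rewrite inE => /orP[/eqP->|ys] nGy; [left|right; exists y].
Qed.

(** Reduces provability to membership in every MCS, so that the modal derivations below become
    pointwise arguments. *)
Lemma ILP_MCS A : (forall G, MCS G -> G A) -> ILP A.
Proof.
move=> allA; apply: contrapT => nA.
have [|G mG /(_ (Neg A) erefl)] := @Lindenbaum [set Neg A].
  move=> s sNA ds; apply: nA; apply: ILP_taut_MP ds => v /=.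
  rewrite truth_bigAnd; case vA: (truth_value v A); rewrite ?implybT //.
  suff -> : all (truth_value v) s by [].
  by apply/allP => x /sNA /= -> /=; rewrite vA.
by move/(MCS_Neg _ mG); apply; apply: allA.
Qed.

(** * Modal principles inside a maximal consistent set *)

Section ModalReasoning.
Variables (G : set form) (mG : MCS G).

Lemma MCS_Nec A : (forall D, MCS D -> D A) -> G (Box A).
Proof. by move=> allA; apply: MCS_ILP => //; apply/rule_Nec/ILP_MCS. Qed.

Lemma Box_MP A B : G (Box (A ~~> B)) -> G (Box A) -> G (Box B).
Proof.
by move=> GAB; apply: (MCS_MP mG (MCS_MP mG (MCS_ILP mG (ax_K _ A B)) GAB)).
Qed.

Lemma Box_mono A B :
  (forall D, MCS D -> D A -> D B) -> G (Box A) -> G (Box B).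
Proof.
move=> AB; apply: Box_MP; apply: MCS_Nec => D mD.
by apply/MCS_Imp => //; apply: AB.
Qed.

Lemma Box_Loeb A : G (Box (Box A ~~> A)) -> G (Box A).
Proof. by apply: MCS_MP => //; apply: MCS_ILP mG (ax_L _ _). Qed.

Lemma Rhd_Box A B : G (Box (A ~~> B)) -> G (A |> B).
Proof. by apply: MCS_MP => //; apply: MCS_ILP mG (ax_J1 _ _ _). Qed.

Lemma Rhd_sub A B : (forall D, MCS D -> D A -> D B) -> G (A |> B).
Proof.
by move=> AB; apply/Rhd_Box/MCS_Nec => D mD; apply/MCS_Imp => //; apply: AB.
Qed.

Lemma Rhd_trans A B C : G (A |> B) -> G (B |> C) -> G (A |> C).
Proof.
move=> AB BC; apply: (MCS_MP mG (MCS_ILP mG (ax_J2 _ A B C))).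
exact/MCS_And.
Qed.

Lemma Rhd_Or A B C : G (A |> C) -> G (B |> C) -> G (A `\/` B |> C).
Proof.
move=> AC BC; apply: (MCS_MP mG (MCS_ILP mG (ax_J3 _ A B C))).
exact/MCS_And.
Qed.

Lemma Rhd_Dia A B : G (A |> B) -> G (Box (Neg B)) -> G (Box (Neg A)).
Proof.
move=> AB NB; apply: contrapT => /(MCS_Neg _ mG) DA.
have := MCS_MP mG (MCS_MP mG (MCS_ILP mG (ax_J4 _ A B)) AB) DA.
by move/(MCS_Neg _ mG).
Qed.

Lemma Dia_Rhd A : G (Dia A |> A).
Proof. exact: MCS_ILP mG (ax_J5 _ _). Qed.

Lemma Rhd_P A B : G (A |> B) -> G (Box (A |> B)).
Proof.
by apply: MCS_MP => //; apply: MCS_ILP => //; apply: ax_extra; exists A, B.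
Qed.

(** J4 gives one direction and J1 the other. Hence [precS] with the empty label is [prec]. *)
Lemma Neg_Rhd_Bot A : G (Neg A |> Bot) <-> G (Box A).
Proof.
split=> [/Rhd_Dia GA|GA].
  have {}GA : G (Box (Neg (Neg A))).
    by apply: GA; apply: MCS_Nec => D mD; apply/MCS_Neg => // /MCS_Bot; apply.
  by apply: Box_mono GA => D mD; rewrite !MCS_Neg // => /contrapT.
apply: Rhd_Box; apply: Box_mono GA => D mD DA.
by apply/MCS_Imp => // /MCS_Neg; case.
Qed.

End ModalReasoning.

(** This is J5 up to a double negation; it serves to eliminate the boxed members of [boxdot]. *)
Lemma Rhd_BoxNeg G A : MCS G -> G (Neg (Box A) |> Neg A).
Proof.
move=> mG; apply: Rhd_trans (Dia_Rhd mG _) => //.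
apply: Rhd_sub => // D mD; rewrite /Dia !(MCS_Neg _ mD); apply: contra_not.
by apply: Box_mono => // E mE; rewrite !MCS_Neg // => /contrapT.
Qed.

(** Let [C] be the right-hand side. [Box (Neg C)] gives [Box (Box (Neg A) ~~> Neg A)], hence
    [Box (Neg A)] by L. So [A] implies [C] or [Dia C], and both interpret [C], the latter by J5. *)
Lemma Rhd_Loeb G A : MCS G -> G (A |> A `/\` Box (Neg A)).
Proof.
move=> mG; set C := A `/\` _.
apply: (@Rhd_trans _ mG _ (C `\/` Dia C)); last first.
  by apply: Rhd_Or => //; [exact: Rhd_sub | exact: Dia_Rhd].
apply: Rhd_sub => // D mD DA; apply/MCS_Or => //.
have [DNA|nDNA] := pselect (D (Box (Neg A))).
  by left; apply/MCS_And.
right; apply/MCS_Neg => //; apply: contra_not nDNA => DNC.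
apply: Box_Loeb => //; apply: Box_mono DNC => // E mE.
rewrite !(MCS_Neg, MCS_And, MCS_Imp) //.
tauto.
Qed.

(* The principle W: by P, [A |> B] holds at all successors, where J4 turns
   [Box ~B] into [Box ~A]. *)
Lemma Rhd_W G A B : MCS G -> G (A |> B) -> G (A |> B `/\` Box (Neg A)).
Proof.
move=> mG AB; apply: (Rhd_trans mG AB); apply: (Rhd_trans mG (Rhd_Loeb B mG)).
apply: Rhd_Box => //; apply: Box_mono (Rhd_P mG AB) => // D mD DAB.
apply/MCS_Imp => // /(MCS_And _ _ mD)[DB DNB]; apply/MCS_And => //.
by split=> //; apply: Rhd_Dia DAB DNB.
Qed.

(** * Assuring successors *)

(* The membership condition shared by [precS] and [boxdot]. *)
Definition rhdS (G T : set form) (A : form) : Prop :=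
  exists2 s : seq form, [set` s] `<=` T & G (A |> bigOr (map Neg s)).

Lemma precSP S G D :
  precS S G D <-> forall A, rhdS G S (Neg A) -> D A /\ D (Box A).
Proof.
split=> GD A; first by move=> [s sS] /GD; apply.
by move=> s sS GA; apply: GD; exists s.
Qed.

Lemma boxdotP G T C :
  boxdot G T C <-> exists2 A, rhdS G T (Neg A) & C = A \/ C = Box A.
Proof.
by split=> [[A [s [? ? ?]]]|[A [s ? ?] ?]]; exists A => //; exists s.
Qed.

Lemma precS_boxdot S G D : precS S G D <-> boxdot G S `<=` D.
Proof.
split=> [/precSP GD C /boxdotP[A /GD[DA DBA] [->|->]] //|GD].
by apply/precSP => A GA; split; apply: GD; apply/boxdotP; exists A => //;
  [left | right].
Qed.

Lemma precS_sub S T G D : S `<=` T -> precS T G D -> precS S G D.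
Proof. by move=> ST GD A s sS; apply: GD; apply: subset_trans ST. Qed.

Section Rhds.
Variables (G : set form) (mG : MCS G).

Lemma rhdS_mem T x : T x -> rhdS G T (Neg x).
Proof.
move=> Tx; exists [:: x]; first by move=> y /=; rewrite inE => /eqP->.
by apply: Rhd_sub => // D mD; rewrite MCS_bigOr_Neg // MCS_Neg // => ?;
  exists x => //; rewrite mem_head.
Qed.

Lemma rhdS_bigOr S s :
  (forall x, x \in s -> rhdS G S (Neg x)) -> rhdS G S (bigOr (map Neg s)).
Proof.
elim: s => [|x s IHs] sS /=.
  by exists [::] => //; apply: Rhd_sub.
have [|t tS Gt] := IHs; first by move=> y ys; apply: sS; rewrite inE ys orbT.
have [r rS Gr] := sS x (mem_head _ _).
have Gcat q : {subset q <= r ++ t} ->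
    G (bigOr (map Neg q) |> bigOr (map Neg (r ++ t))).
  move=> qrt; apply: Rhd_sub => // D mD; rewrite !MCS_bigOr_Neg //.
  by move=> [y yq Dy]; exists y => //; apply: qrt.
exists (r ++ t); first by move=> y /=; rewrite mem_cat => /orP[/rS|/tS].
by apply: Rhd_Or => //; [apply: (Rhd_trans mG Gr) | apply: (Rhd_trans mG Gt)];
  apply: Gcat => y yq; rewrite mem_cat yq ?orbT.
Qed.

Lemma rhdS_Rhd T A B : G (A |> B) -> rhdS G T B -> rhdS G T A.
Proof. by move=> AB [s sT BT]; exists s => //; apply: Rhd_trans AB BT. Qed.

Lemma rhdS_trans S T A :
  rhdS G S A -> (forall x, S x -> rhdS G T (Neg x)) -> rhdS G T A.
Proof.
move=> [s sS GA] ST; apply: rhdS_Rhd GA _.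
by apply: rhdS_bigOr => x /sS /ST.
Qed.

Lemma rhdS_Neg_Bot T A : G (Box A) -> rhdS G T (Neg A).
Proof. by move=> GA; exists [::] => //; apply/Neg_Rhd_Bot. Qed.

Lemma rhdS_set0 A : rhdS G set0 (Neg A) <-> G (Box A).
Proof.
split=> [[[|x s] s0]|/rhdS_Neg_Bot //]; first by move/Neg_Rhd_Bot; apply.
by have := s0 x (mem_head _ _).
Qed.

(** A cut: the negation of each member of [boxdot G T] already interprets negations from [T], by
    definition for the unboxed members and through [Rhd_BoxNeg] for the boxed ones. *)
Lemma rhdS_boxdot T A : rhdS G (boxdot G T) A -> rhdS G T A.
Proof.
move=> GA; apply: rhdS_trans GA _ => x /boxdotP[B GB [->|->]] //.
by apply: rhdS_Rhd GB; apply: Rhd_BoxNeg.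
Qed.

Lemma prec_precS0 D : prec G D <-> precS set0 G D.
Proof.
split=> [GD|/precSP GD A GA]; last by apply: GD; apply/rhdS_set0.
by apply/precSP => A /rhdS_set0 /GD.
Qed.

Lemma precS_prec T D : precS T G D -> prec G D.
Proof. by move=> GD; apply/prec_precS0; apply: precS_sub GD. Qed.

Lemma precS_mem T D : precS T G D -> forall x, T x -> D x /\ D (Box x).
Proof. by move=> /precSP GD x /rhdS_mem /GD. Qed.

Lemma precS_prec_trans T D E : precS T G D -> prec D E -> precS T G E.
Proof. by move=> GD DE A s sT /(GD _ _ sT)[_ /DE]. Qed.

(** Were [boxdot G T] inconsistent with [A] and [Box (Neg A)], these two would imply a finite
    disjunction of negations from [boxdot G T]; [Rhd_Loeb] and [rhdS_boxdot] would then yield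
    [rhdS G T A]. The formula [Box (Neg A)] later makes the successor a world of the structure. *)
Lemma rhdS_exists_successor T A : ~ rhdS G T A ->
  exists D, [/\ MCS D, precS T G D, D A & D (Box (Neg A))].
Proof.
move=> nGA; pose X := boxdot G T `|` ([set A] `|` [set Box (Neg A)]).
have [|D mD XD] := @Lindenbaum X.
  move=> s sX ds; apply: nGA.
  apply: (rhdS_Rhd (Rhd_Loeb A mG)); apply: rhdS_boxdot.
  pose good x := (x != A) && (x != Box (Neg A)).
  exists [seq x <- s | good x].
    move=> x /=; rewrite mem_filter => /andP[/andP[/eqP xA /eqP xNA] /sX].
    by case=> // -[/xA|/xNA].
  apply: Rhd_sub => // D mD /(MCS_And _ _ mD)[DA DNA].
  apply/MCS_bigOr_Neg => //; apply: contrapT => nex.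
  apply: (MCS_Bot mD); apply: (MCS_MP mD (MCS_ILP mD ds)).
  apply/MCS_bigAnd => // x /= xs; apply: contrapT => nDx; apply: nex.
  exists x => //; rewrite mem_filter xs andbT.
  by apply/andP; split; apply/eqP => xE; apply: nDx; rewrite xE.
exists D; split=> //.
- by apply/precS_boxdot => x Gx; apply: XD; left.
- by apply: XD; right; left.
- by apply: XD; right; right.
Qed.

(** W adds [Box (Neg A)] to the interpreted disjunction, which rules out the disjunct negating that
    very formula. *)
Lemma rhdS_W S A : rhdS G (S `|` [set Box (Neg A)]) A -> rhdS G S A.
Proof.
move=> [s sS GA]; exists [seq x <- s | x != Box (Neg A)].
  move=> x /=; rewrite mem_filter => /andP[/eqP xNA /sS[//|]].
  by move/xNA.
apply: (Rhd_trans mG (Rhd_W mG GA)); apply: Rhd_sub => // D mD.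
rewrite MCS_And // !MCS_bigOr_Neg // => -[[x xs nDx] DNA].
exists x => //; rewrite mem_filter xs andbT.
by apply/eqP => xE; apply: nDx; rewrite xE.
Qed.

End Rhds.

(* This is where the scheme P is used: it moves a |>-formula from [G] to [D]. *)
Lemma rhdS_descend S X T G D A :
  MCS G -> MCS D -> precS S G D -> X `<=` T ->
  rhdS G (S `|` X `|` boxdot D T) A -> rhdS D T A.
Proof.
move=> mG mD GD XT [s sU /(Rhd_P mG) GA].
have [DA _] := precS_prec mG GD GA.
apply: (rhdS_Rhd mD DA); apply: rhdS_bigOr => // x /sU[[Sx|Xx]|DTx].
- by apply: rhdS_Neg_Bot => //; case: (precS_mem mG GD Sx).
- by apply: rhdS_mem => //; apply: XT.
- by apply: rhdS_boxdot => //; apply: rhdS_mem.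
Qed.

Lemma QsetSS w S B i : Qset w S B i.+2 =
  S i.+2 `|` [set Box (Neg B)] `|` boxdot (w i.+1) (Qset w S B i.+1).
Proof. by []. Qed.

(** The strict bounds on [w] leave both ends of the chain free: one end is replaced for
    quasi-transitivity, and the chain is prolonged for [Pgen]. *)
Lemma eq_Qset w w' S S' B n :
  (forall i, 0 < i < n -> w i = w' i) ->
  (forall i, 0 < i <= n -> S i = S' i) ->
  Qset w S B n = Qset w' S' B n.
Proof.
elim: n => // -[|n] IHn ww' SS'; first by rewrite /= SS'.
rewrite !QsetSS SS' ?ww' ?leqnn //; congr (_ `|` boxdot _ _).
by apply: IHn => i /andP[i0 le_in]; [apply: ww' | apply: SS'];
  rewrite i0 /= leqW.
Qed.

Lemma labelled_chain_not_rhdS n ws Ss w u A : 0 < n ->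
  labelled_chain n ws Ss w u -> u A -> ~ rhdS w (Qset ws Ss A n) A.
Proof.
move=> n0 [mws <- <- chain] wA.
elim: n n0 mws chain => // -[|n] IHn _ mws chain.
  (* For one step, W leaves only the label [Ss 1], so [precS] puts [Neg A] into [ws 0], which
     contains [A]. *)
  move=> /(rhdS_W (mws 1 isT)) [s sS GA].
  have [] := chain 0 isT (Neg A) s sS; last by move/(MCS_Neg _ (mws 0 isT)).
  apply: Rhd_trans GA; first exact: mws.
  apply: Rhd_sub => [|D mD]; first exact: mws.
  by rewrite !MCS_Neg // => /contrapT.
move=> wQ; apply: IHn => // [i ilen|i iltn|]; first exact/mws/leqW.
  exact/chain/leqW.
apply: rhdS_descend (mws _ (leqnn _)) (mws _ (leqnSn _))
  (chain _ (leqnn _)) _ wQ.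
(* [Box (Neg A)] sits at a different depth of the union at index 1, where [Qset] has no [boxdot]
   layer. *)
by case: n {mws chain} => [|n] x ->; [right | left; right].
Qed.

(** * The structure of an appropriate set *)

Lemma subforms_refl A : A \in subforms A.
Proof. by case: A => *; rewrite mem_head. Qed.

Lemma subforms_trans A B C :
  C \in subforms B -> B \in subforms A -> C \in subforms A.
Proof.
move=> CB; elim: A => [|p|A IHA A' IHA'|A IHA|A IHA A' IHA'];
  rewrite [X in X -> _]/= in_cons => /orP[/eqP BE|] //; rewrite ?BE // in CB *.
- by rewrite mem_cat /= inE mem_cat => /orP[/IHA|/IHA'] ->; rewrite ?orbT.
- by rewrite /= inE => /IHA ->; rewrite orbT.
- by rewrite mem_cat /= inE mem_cat => /orP[/IHA|/IHA'] ->; rewrite ?orbT.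
Qed.

Lemma single_negP A :
  (exists2 B, A = Neg B & single_neg A = B) \/ single_neg A = Neg A.
Proof.
case: A => [|p|A [|q|B C|B|B C]|A|A B]; try by right.
by left; exists A.
Qed.

Lemma exists_appropriate A : exists2 D, appropriate D & D A.
Proof.
(* The appropriate set is [X] with the plain negations of its members: [single_neg] sends [X] into
   this set and strips the added negations. [Bot] is listed because it is a subformula of each
   negation. *)
have [X [XA XT XB Xsub]] : exists X : seq form,
    [/\ A \in X, Top \in X, Bot \in X
    & forall B C, B \in X -> C \in subforms B -> C \in X].
  exists (subforms A ++ subforms Top).
  split; rewrite ?mem_cat ?subforms_refl ?orbT //.
  move=> B C; rewrite !mem_cat => /orP[BA|BT] CB.
    by rewrite (subforms_trans CB BA).
  by rewrite (subforms_trans CB BT) orbT.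
exists [set` X ++ map Neg X]; last by rewrite /= mem_cat XA.
split; [exact: finite_seq | by rewrite /= mem_cat XT | |].
  move=> B C /=; rewrite !mem_cat => /orP[BX CB|/mapP[B' B'X ->]].
    by rewrite (Xsub B).
  rewrite /= inE mem_cat => /orP[/eqP->|/orP[CB'|]].
  - by rewrite map_f ?orbT.
  - by rewrite (Xsub B').
  - by rewrite inE => /eqP->; rewrite XB.
move=> B /=; rewrite !mem_cat => /orP[BX|/mapP[B' B'X ->]]; last first.
  by rewrite /= B'X.
have [[C BE ->]|->] := single_negP B; last by rewrite map_f ?orbT.
have -> // : C \in X.
by apply: (Xsub _ _ BX); rewrite BE /= inE mem_cat subforms_refl orbT.
Qed.

(** * Worlds of the structure and the truth lemma *)

Section ILWP.
Variable D : set form.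
Hypothesis appD : appropriate D.
Implicit Types w u v : ILWP_world D.

Let mth w : MCS (theory w) := theory_MCS w.

Lemma ILWP_Racc_trans w u v : ILWP_Racc w u -> ILWP_Racc u v -> ILWP_Racc w v.
Proof. by move=> wu uv A /wu[_ /uv]. Qed.

Lemma ILWP_Rdot_sub u v : ILWP_Rdot u v -> ILWP_Rdot v `<=` ILWP_Rdot u.
Proof.
move=> [uv|->] // x [vx|->]; last by left.
by left; apply: ILWP_Racc_trans vx.
Qed.

Lemma precS_ILWP_Rdot S w u v :
  precS S (theory w) (theory u) -> ILWP_Rdot u v ->
  precS S (theory w) (theory v).
Proof. by move=> wu [uv|-> //]; apply: precS_prec_trans uv. Qed.

Lemma ILWP_exists A (G : set form) : MCS G -> D A -> G A -> G (Box (Neg A)) ->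
  exists w, theory w = G.
Proof.
move=> mG DA GA GNA; have h : exists2 B, D B & G (B `/\` Box (Neg B)).
  by exists A => //; apply/MCS_And.
by exists (ILWPWorld mG h).
Qed.

(** [D] need not contain [Neg A], so [single_neg A] serves as the formula that qualifies [G] as a
    world. *)
Lemma ILWP_exists_single_neg A (G : set form) :
  MCS G -> D A -> G (Neg A) -> G (Box A) -> exists w, theory w = G.
Proof.
move=> mG DA GNA GA; apply: (@ILWP_exists (single_neg A)) => //.
- by case: appD => _ _ _; apply.
- have [[C AE ->]|->//] := single_negP A.
  by move: GNA; rewrite AE !MCS_Neg // => /contrapT.
- have [[C AE ->]|->] := single_negP A.
  + by rewrite -AE.
  + by apply: Box_mono GA => // E mE; rewrite !MCS_Neg //; tauto.
Qed.

(** Fed to the chain clause of [ILWP_Sacc], it yields a [v] reached from [w] under a label that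
    includes [S]. *)
Lemma labelled_chain1 S w u : precS S (theory w) (theory u) ->
  labelled_chain 1 (fun i => if i is 0 then theory u else theory w) (fun=> S)
    (theory w) (theory u).
Proof. by move=> wu; split=> // [[|i] _|[|i]]. Qed.

Lemma ILWP_truth A : D A ->
  forall w, forces (@ILWP_val D) w A <-> theory w A.
Proof.
have [_ _ subD _] := appD.
elim: A => [|p|A IHA B IHB|A IHA|A IHA B IHB] DA w /=.
- by split=> // /(MCS_Bot (mth w)).
- by [].
- have DA' : D A.
    by apply: (subD _ _ DA); rewrite /= inE mem_cat subforms_refl !orbT.
  have DB' : D B.
    by apply: (subD _ _ DA); rewrite /= inE mem_cat subforms_refl !orbT.
  by rewrite (IHA DA') (IHB DB') (MCS_Imp _ _ (mth w)).
- have DA' : D A by apply: (subD _ _ DA); rewrite /= inE subforms_refl orbT.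
  split=> [wA|wA u /(_ _ wA)[uA _]]; last exact/IHA.
  apply: contrapT => nwA.
  have [|G [mG wG GNA GNNA]] := @rhdS_exists_successor _ (mth w) set0 (Neg A).
    by rewrite rhdS_set0 //; apply: mth.
  have GA : G (Box A).
    by apply: Box_mono GNNA => // E mE; rewrite !MCS_Neg // => /contrapT.
  have [u uG] := ILWP_exists_single_neg mG DA' GNA GA.
  have /(IHA DA') : forces (@ILWP_val D) u A.
    by apply: wA; rewrite /ILWP_Racc /= uG; apply: precS_prec wG; apply: mth.
  by rewrite uG; apply/MCS_Neg.
have DA' : D A.
  by apply: (subD _ _ DA); rewrite /= inE mem_cat subforms_refl !orbT.
have DB' : D B.
  by apply: (subD _ _ DA); rewrite /= inE mem_cat subforms_refl !orbT.
split=> [wAB|wAB u wu /(IHA DA') uA].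
  apply: contrapT => nwAB.
  have [|G [mG wG GA GNA]] := @rhdS_exists_successor _ (mth w) [set Neg B] A.
    move=> [s sB wA]; apply: nwAB; apply: (Rhd_trans (mth w) wA).
    apply: Rhd_sub => [|E mE]; first exact: mth.
    by rewrite MCS_bigOr_Neg // => -[x /sB ->]; rewrite MCS_Neg // => /contrapT.
  have [u uG] := ILWP_exists mG DA' GA GNA; rewrite -uG in mG wG GA GNA.
  have [|V [wu Vw uV] VB] := wAB u (precS_prec (mth w) wG); first exact/IHA.
  suff [v Vv wv] : exists2 v, V v & precS [set Neg B] (theory w) (theory v).
    have [/(MCS_Neg _ (mth v)) + _] := precS_mem (mth w) wv erefl.
    by apply; apply/IHB => //; apply: VB.
  case: uV => [[v [Vv uv]]|/(_ 1 _ _ isT (labelled_chain1 wG))].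
    by exists v => //; apply: precS_ILWP_Rdot uv.
  move=> [v [C [Vv _ wv]]]; exists v => //; apply: precS_sub wv.
  exact: subsetUl.
(* The largest candidate is taken: all successors of [w] containing [B]. *)
exists [set v | ILWP_Racc w v /\ theory v B]; last first.
  by move=> v [_ vB]; apply/IHB.
split=> //; first by move=> v [].
right=> n ws Ss n0 chain.
have [|G [mG wG GB GNB]] :=
    @rhdS_exists_successor _ (mth w) (Qset ws Ss A n) B.
  by move/(rhdS_Rhd (mth w) wAB); apply: labelled_chain_not_rhdS chain uA.
have [v vG] := ILWP_exists mG DB' GB GNB.
(* The formula demanded by the chain clause is the antecedent [A], which lies in [u] itself. *)
exists v, A; rewrite -vG in wG GB; split=> //.
- by split=> //; apply: precS_prec wG; apply: mth.
- by split=> //; exists u => //; right.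
Qed.

(** * Frame conditions of the structure *)

Lemma sub_count_lt (T : eqType) (p q : pred T) (s : seq T) x :
  subpred p q -> x \in s -> q x -> ~~ p x -> count p s < count q s.
Proof.
move=> pq xs qx npx; have /permP sE := perm_to_rem xs.
by rewrite !sE /= qx (negbTE npx) ltnS sub_count.
Qed.

(* Along [R], the finite set of formulas [B] of [D] with [Box (Neg B)] in the
   theory grows strictly. *)
Lemma ILWP_Racc_cwf : well_founded (fun x y : ILWP_world D => ILWP_Racc y x).
Proof.
have [/finite_seqP[s DE] _ _ _] := appD.
pose m w := count (fun B => ~~ `[< theory w (Box (Neg B)) >]) s.
suff mlt w u : ILWP_Racc w u -> m u < m w.
  move=> w; move: {2}(m w) (leqnn (m w)) => n; elim: n w => [|n IHn] w lwn.
    by constructor=> u /mlt /leq_trans /(_ lwn); rewrite ltn0.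
  constructor=> u /mlt lum; apply: IHn; rewrite -ltnS.
  exact: leq_trans lum lwn.
(* The [B] qualifying [u] as a world is the new formula: [Box (Neg B)] in [w] would put [Neg B] into
   [u]. *)
move=> wu; have [B DB /(MCS_And _ _ (mth u))[uB uNB]] := theory_D u.
apply: (@sub_count_lt _ _ _ _ B) _ _ _ => [C|||]/=.
- by apply: contra => /asboolP/wu[_ ?]; apply/asboolP.
- by move: DB; rewrite DE.
- by apply/asboolP => /wu[/(MCS_Neg _ (mth u))].
- by apply/negPn/asboolP.
Qed.

Lemma ILWP_gv_frame : inhabited (ILWP_world D) -> gv_frame (ILWP_structure D).
Proof.
move=> inh; split.
- exact: inh.
- exact: ILWP_Racc_trans.
- exact: ILWP_Racc_cwf.
- move=> w u V [wu Vw uV]; split=> //.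
  case: uV => [[v [Vv _]]|]; first by exists v.
  have/labelled_chain1 ch : precS set0 (theory w) (theory u).
    by apply/prec_precS0 => //; apply: mth.
  by move=> /(_ 1 _ _ isT ch)[v [B [Vv _ _]]]; exists v.
- move=> w u wu; split=> //; first by move=> x ->.
  by left; exists u; split=> //; right.
- move=> w u V Z [wu Vw uV] VZ; split=> //.
    by move=> z [v /VZ[_ Zw _] /Zw].
  case: uV => [[v [Vv uv]]|uV].
    have [wv _ [[z [Zz vz]]|vZ]] := VZ _ Vv.
      by left; exists z; split; [exists v | apply: ILWP_Rdot_sub vz].
    right=> n ws Ss n0 chain.
    (* As [v] is [u] or a successor of it, a chain ending in [u] may end in [v] instead; [Qset] does
       not depend on index 0. *)
    pose ws' i := if i is 0 then theory v else ws i.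
    have QE B : Qset ws' Ss B n = Qset ws Ss B n.
      by apply: eq_Qset => // -[].
    have chain' : labelled_chain n ws' Ss (theory w) (theory v).
      have [mws wsn ws0 ch] := chain; split=> //.
      + by move=> [|i] /= ilen; [exact: mth | exact: mws].
      + by case: (n) n0 wsn.
      + move=> [|i] iltn /=; last exact: ch.
        have := ch 0 iltn; rewrite ws0; case: uv => [uv|-> //] c.
        exact: precS_prec_trans c uv.
    have [z [B [Zz [DB [x vx xB]] wz]]] := vZ _ _ _ n0 chain'.
    exists z, B; split; first by exists v.
      by split=> //; exists x => //; apply: ILWP_Rdot_sub vx.
    by rewrite -QE.
  right=> n ws Ss n0 chain.
  have [v [B [Vv DB wv]]] := uV _ _ _ n0 chain.
  have [_ _ [[z [Zz vz]]|vZ]] := VZ _ Vv.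
    exists z, B; split=> //; first by exists v.
    exact: precS_ILWP_Rdot vz.
  (* The whole set [Qset ws Ss B n] serves as the label of a single step to [v]; the resulting label
     includes it, so [B] still works for [z]. *)
  have [z [C [Zz _ wz]]] := vZ 1 _ _ isT (labelled_chain1 wv).
  exists z, B; split=> //; first by exists v.
  by apply: precS_sub wz; apply: subsetUl.
- move=> w u v wu uv; split=> //.
    by move=> x ->; apply: ILWP_Racc_trans uv.
  by left; exists v; split=> //; left.
- move=> w u V Z [wu Vw uV] VZ Zw; split=> //.
  case: uV => [[v [Vv uv]]|uV]; first by left; exists v; split=> //; apply: VZ.
  right=> n ws Ss n0 /(uV _ _ _ n0)[v [B [Vv DB wv]]].
  by exists v, B; split=> //; apply: VZ.
Qed.

Lemma ILWP_Pgen : Pgen (ILWP_structure D).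
Proof.
move=> w w' u V ww' w'u [wu Vw uV].
case: uV => [[v [Vv uv]]|uV].
  exists [set v]; first by move=> x ->.
  split=> //; last by left; exists v.
  by move=> x ->; case: uv => [uv|-> //]; apply: ILWP_Racc_trans uv.
exists (V `&` ILWP_Racc w'); first exact: subIsetl.
split=> //.
right=> n ws Ss n0 chain.
(* The chain gets one more step at index [n.+1], from [w] to [w'] with empty label. *)
pose ws' i := if i <= n then ws i else theory w.
pose Ss' i := if i <= n then Ss i else set0.
have [mws wsn ws0 ch] := chain.
have QE B : Qset ws' Ss' B n = Qset ws Ss B n.
  apply: eq_Qset => i /andP[_ le_in]; last by rewrite /Ss' le_in.
  by rewrite /ws' (ltnW le_in).
have chain' : labelled_chain n.+1 ws' Ss' (theory w) (theory u).
  split; rewrite /ws' ?ltnn //.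
  - by move=> i _; case: ifP => [/mws|_]; last exact: mth.
  - move=> i iltn; rewrite /Ss'; have [iSn|] := leqP i.+1 n.
      by rewrite (ltnW iSn); apply: ch.
    rewrite ltnS => nlei.
    have -> : i = n by apply/eqP; rewrite eqn_leq nlei andbT.
    by rewrite leqnn wsn; apply/prec_precS0 => //; apply: mth.
have [v [B [Vv DB wv]]] := uV _ _ _ (ltn0Sn n) chain'.
have w'v : precS (Qset ws Ss B n) (theory w') (theory v).
  apply/precS_boxdot => x w'x.
  have [] // := precS_mem (mth w) wv (x := x).
  rewrite -(prednK n0) QsetSS (prednK n0) QE /ws' leqnn wsn.
  by right.
exists v, B; split=> //; split=> //; apply: precS_prec w'v; exact: mth.
Qed.

End ILWP.

(** * Completeness by refuting unprovable formulas *)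

Theorem theorem11p5 :
  (forall A : form,
     (forall F : structure, gv_frame F -> Pgen F -> valid F A) -> ILP A) /\
  (forall A : form,
     (forall D : set form, appropriate D ->
        forall w : world (ILWP_structure D), forces (@ILWP_val D) w A) ->
     ILP A).
Proof.
have refute A : ~ ILP A -> exists D (w : ILWP_world D),
    appropriate D /\ ~ forces (@ILWP_val D) w A.
  move=> nA; have [D appD DA] := exists_appropriate A; exists D.
  (* Omitting [A] is not enough for a world. By necessitation and L, [Box A ~~> A] is unprovable as
     well, and an MCS omitting it contains [Box A] and [Neg A]. *)
  have [G mG nGA] : exists2 G, MCS G & ~ G (Box A ~~> A).
    apply: contrapT => nG; apply: nA.
    have dA : ILP (Box A ~~> A).
      by apply: ILP_MCS => G mG; apply: contrapT => nGA; apply: nG; exists G.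
    apply: (rule_MP dA); apply: rule_MP (ax_L _ _) _; exact: rule_Nec.
  have [GA nA'] : G (Box A) /\ ~ G A.
    by move: nGA; rewrite MCS_Imp // => /not_implyP.
  have [|w wG] := ILWP_exists_single_neg appD mG DA _ GA; first exact/MCS_Neg.
  by exists w; split=> //; rewrite ILWP_truth // wG.
split=> A vA; apply: contrapT => /refute[D [w [appD]]]; apply.
  exact: (vA _ (ILWP_gv_frame appD (inhabits w)) (@ILWP_Pgen D)).
exact: vA.
Qed.
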